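(* Let $k\ge 2$ be a fixed integer. Then, as $m\to\infty$, $$\chi_{\ell}(K^k(k,m),1)=(1+o(1))\,\chi_{\ell}(K^k(k,m))=(1+o(1))\log_{k} m,$$ i.e. both $\chi_{\ell}(K^k(k,m),1)/\log_k m\to 1$ and $\chi_{\ell}(K^k(k,m))/\log_k m\to 1$.
   Context: $K^k(k,m)$ is the complete $k$-uniform $k$-partite hypergraph with $k$ partite sets $V_1,\dots,V_k$ each of size $m$: its edges are all $k$-sets containing exactly one vertex from each $V_i$. For a hypergraph $G$, a list $L$ assigns to each vertex $v$ a set $L(v)$ of colors; $G$ is $L$-colorable if there is a coloring $f$ with $f(v)\in L(v)$ for all $v$ such that no edge is monochromatic. $L$ is an $l$-list if $|L(v)|=l$ for all $v$. $\chi_{\ell}(G)$ is the least $l$ such that $G$ is $L$-colorable from every $l$-list. For a positive integer $s$, a list $L$ is $s$-separated if $|L(u)\cap L(v)|\le s$ whenever some edge of $G$ contains both $u$ and $v$; $\chi_{\ell}(G,s)$ is the least $l$ such that $G$ is $L$-colorable from every $s$-separated $l$-list. *)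

(* Defs.v *)
From mathcomp Require Import all_boot all_order all_algebra.
From mathcomp Require Import all_classical all_reals all_analysis.

Set Implicit Arguments.
Unset Strict Implicit.
Unset Printing Implicit Defensive.

Record hypergraph := Hypergraph {
  vertex : finType;
  edges : {set {set vertex}}
}.

Section ListColoring.
Variable G : hypergraph.

Definition monochromatic (C : Type) (f : vertex G -> C) (e : {set vertex G}) : Prop :=
  exists c : C, forall v, v \in e -> f v = c.

Definition list_colorable (C : finType) (L : vertex G -> {set C}) : Prop :=
  exists f : vertex G -> C,
    (forall v, f v \in L v) /\
    (forall e, e \in edges G -> ~ monochromatic f e).

Definition is_list_of_size (l : nat) (C : finType) (L : vertex G -> {set C}) : Prop :=
  forall v, #|L v| = l.

(* The vertices u and v are distinct: with u = v allowed, no l-list with l > s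
   would be s-separated on a hypergraph that has a nonempty edge. *)
Definition separated (s : nat) (C : finType) (L : vertex G -> {set C}) : Prop :=
  forall u v : vertex G, u != v ->
    (exists2 e, e \in edges G & (u \in e) && (v \in e)) ->
    #|L u :&: L v| <= s.

(* G has finitely many vertices, so the union of the lists is finite and it is
   no restriction to draw the colors from a finite type; C is arbitrary. *)
Definition choosable (l : nat) : Prop :=
  forall (C : finType) (L : vertex G -> {set C}),
    is_list_of_size l L -> list_colorable L.

Definition sep_choosable (s l : nat) : Prop :=
  forall (C : finType) (L : vertex G -> {set C}),
    is_list_of_size l L -> separated s L -> list_colorable L.

End ListColoring.

Definition is_least (P : nat -> Prop) (n : nat) : Prop :=
  P n /\ forall j, P j -> n <= j.

(* The default value 0 is taken only if no number satisfies P. *)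
Definition least (P : nat -> Prop) : nat := xget 0 (is_least P).

Definition list_chromatic (G : hypergraph) : nat := least (choosable G).

Definition sep_list_chromatic (G : hypergraph) (s : nat) : nat :=
  least (sep_choosable G s).

Definition part (k m : nat) (i : 'I_k) : {set 'I_k * 'I_m} :=
  [set v : 'I_k * 'I_m | v.1 == i].

Definition complete_partite (k m : nat) : hypergraph :=
  @Hypergraph ('I_k * 'I_m)%type
    [set e : {set 'I_k * 'I_m} |
      (#|e| == k) && [forall i : 'I_k, #|e :&: part m i| == 1]].

Definition logb (R : realType) (k m : nat) : R :=
  (ln (m%:R : R) / ln (k%:R : R))%R.

(* Main.v *)
Require Import Defs.
From mathcomp Require Import all_boot all_order all_algebra.
From mathcomp Require Import all_classical all_reals all_analysis.
From mathcomp Require Import zify ring lra.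

(** Upper bound: forbid each color on one of the [k] parts, chosen uniformly at
    random. No edge can then be monochromatic, and a vertex loses all of its [l]
    colors with probability [k ^- l], so [k ^ l > k * m] suffices.

    Lower bound: the colors are the points of the grid ['I_n ^ k] and the lists of
    part [i] lie on lines parallel to the [i]-th axis, so that lists of different
    parts share at most one color. In a coloring without monochromatic edge each
    color is missed by some part, and averaging over all lines yields a part [i]
    and a line in direction [i] on which at least [n / k] colors are missed by part
    [i]. Every line carries a family of [l]-sets such that each of its subsets with
    [n / k] points contains a member; one of these members is the list of a vertex
    that cannot be colored. For [n = 2 k l ^ 2] the greedy algorithm finds such a
    family of size [k ^ l] times a polynomial in [l], so [m = k ^ ((1 + o(1)) l)]
    suffices. *)
Set Implicit Arguments.
Unset Strict Implicit.
Unset Printing Implicit Defensive.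

(** * Upper bound: choosability by a union bound *)

Lemma edge_meets_part (k m : nat) (e : {set 'I_k * 'I_m}) (i : 'I_k) :
  e \in edges (complete_partite k m) -> exists j, (i, j) \in e.
Proof.
rewrite inE => /andP[_ /forallP/(_ i)/cards1P[[i' j] ev]].
have : (i', j) \in e :&: part m i by rewrite ev set11.
by rewrite !inE /= => /andP[vin /eqP<-]; exists j.
Qed.

Lemma transversal_edge (k m : nat) (h : 'I_k -> 'I_m) :
  [set (i, h i) | i : 'I_k] \in edges (complete_partite k m).
Proof.
rewrite inE card_imset ?card_ord ?eqxx /=; last by move=> i i' [].
apply/forallP => i; apply/cards1P; exists (i, h i).
apply/setP => -[i' j]; rewrite !inE /=; apply/andP/eqP.
  by case=> /imsetP[i'' _ [-> ->]] /eqP ->.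
by case=> -> ->; rewrite eqxx; split=> //; apply: imset_f.
Qed.

(** A uniformly random [g] is constantly [i] on [A] with probability [k ^- #|A|]; this is stated
    without division. *)
Lemma card_ffun_forced (C : finType) (k : nat) (i : 'I_k) (A : {set C}) :
  (#|[set g : {ffun C -> 'I_k} | [forall c in A, g c == i]]| * k ^ #|A| =
   k ^ #|C|)%N.
Proof.
pose F c : pred 'I_k := if c \in A then pred1 i else predT.
have -> : #|[set g : {ffun C -> 'I_k} | [forall c in A, g c == i]]| = #|family F|.
  apply: eq_card => g; rewrite inE; apply/forallP/familyP => H c.
    by have := H c; rewrite /F; case: ifP.
  by apply/implyP => cA; have := H c; rewrite /F cA.
rewrite card_family foldrE big_map big_enum /=.
rewrite (bigID (mem A)) /= big1 ?mul1n; last first.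
  by move=> c cA; rewrite /F cA card1.
rewrite (eq_bigr (fun=> k)); last first.
  by move=> c cA; rewrite /F (negPf cA) -[RHS]card_ord; apply: eq_card.
by rewrite prod_nat_const -expnD addnC cardC.
Qed.

Lemma card_bigcup_leq (I T : finType) (F : I -> {set T}) :
  (#|\bigcup_i F i| <= \sum_i #|F i|)%N.
Proof.
apply: (big_rec2 (fun (A : {set T}) n => #|A| <= n)%N); rewrite ?cards0 //.
by move=> i n A _ le; apply: leq_trans (leq_card_setU _ _) _; rewrite leq_add2l.
Qed.

Lemma complete_partite_choosable (k m l : nat) :
  (0 < k)%N -> (k * m < k ^ l)%N -> choosable (complete_partite k m) l.
Proof.
move=> k_gt0 lt_km C L szL.
(* [g c] is the part where color [c] is forbidden, and [bad v] collects the choices of [g] that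
   leave [v] no color. *)
pose bad (v : 'I_k * 'I_m) := [set g : {ffun C -> 'I_k} | [forall c in L v, g c == v.1]].
have [g gP] : exists g, g \notin \bigcup_v bad v.
  apply/existsP; rewrite -[X in is_true X]negbK negb_exists.
  apply/negP => /forallP /= all_bad.
  have := card_bigcup_leq bad.
  have -> : #|\bigcup_v bad v| = (k ^ #|C|)%N.
    by rewrite -[k in RHS]card_ord -card_ffun; apply: eq_card => g; have := all_bad g; rewrite negbK.
  rewrite leqNgt => /negP[].
  rewrite -(ltn_pmul2r (_ : 0 < k ^ l)%N) ?expn_gt0 ?k_gt0 // big_distrl /=.
  rewrite (eq_bigr (fun=> k ^ #|C|)%N); last first.
    by move=> v _; rewrite -(szL v) card_ffun_forced.
  rewrite sum_nat_const card_prod !card_ord mulnC ltn_pmul2l //.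
  by rewrite expn_gt0 k_gt0.
have {gP} pickP v : exists c, c \in L v /\ g c != v.1.
  have : g \notin bad v by apply: contra gP => gv; apply/bigcupP; exists v.
  by rewrite inE negb_forall => /existsP[c]; rewrite negb_imply => /andP[]; exists c.
have [f fP] := boolp.choice pickP.
exists f; split=> [v|e eE [c fc]]; first by case: (fP v).
have [j je] := edge_meets_part (g c) eE.
by have [_] := fP (g c, j); rewrite (fc _ je) eqxx.
Qed.

(** * Small families of [l]-sets that meet every large set in a member *)

(** By averaging, some [a] hits at least a fraction [1 / D] of the elements not yet hit, so each
    greedy choice shrinks the remainder by a factor [(D - 1) / D]. *)
Lemma greedy_cover (A B : finType) (A0 : {set A}) (hit : A -> B -> bool)
    (B0 : {set B}) (D M : nat) :
  (0 < #|A0|)%N ->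
  (forall b, b \in B0 -> #|A0| <= D * #|[set a in A0 | hit a b]|)%N ->
  exists X : seq A, [/\ size X = M, {subset X <= A0} &
    (D ^ M * #|[set b in B0 | ~~ has (hit^~ b) X]| <= D.-1 ^ M * #|B0|)%N].
Proof.
move=> A0_gt0 hitP; elim: M => [|M [X [szX XA leX]]].
  exists [::]; split=> //; rewrite !expn0 !mul1n.
  by apply: subset_leq_card; apply/fintype.subsetP => b; rewrite inE => /andP[].
set U := [set b in B0 | _] in leX.
have [a aA aP] : exists2 a, a \in A0 & (#|U| <= D * #|[set b in U | hit a b]|)%N.
  apply/exists_inP; rewrite -[X in is_true X]negbK negb_exists_in.
  apply/negP => /forall_inP lt_all.
  have : (\sum_(a in A0) (D * #|[set b in U | hit a b]|) < \sum_(a in A0) #|U|)%N.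
    have /card_gt0P[a0 a0A] := A0_gt0.
    rewrite (bigD1 a0) //= [X in (_ < X)%N](bigD1 a0) //= -addSn.
    apply: leq_add; first by rewrite ltnNge lt_all.
    by apply: leq_sum => a /andP[aA _]; rewrite ltnW // ltnNge lt_all.
  rewrite sum_nat_const -big_distrr /= ltnNge => /negP[].
  (* Double counting of the pairs [(a, b)] with [hit a b]. *)
  have -> : (\sum_(a in A0) #|[set b in U | hit a b]| =
             \sum_(b in U) #|[set a in A0 | hit a b]|)%N.
    under eq_bigr do rewrite -sum1dep_card big_mkcondr.
    under [RHS]eq_bigr do rewrite -sum1dep_card big_mkcondr.
    exact: exchange_big.
  rewrite mulnC -sum_nat_const big_distrr; apply: leq_sum => b.
  by rewrite inE => /andP[/hitP].
exists (a :: X); split; first by rewrite /= szX.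
  by move=> x; rewrite inE => /predU1P[->|/XA].
rewrite /=.
have -> : [set b in B0 | ~~ (hit a b || has (hit^~ b) X)] = U :\: [set b in U | hit a b].
  by apply/setP => b; rewrite !inE; case: (b \in B0); case: (hit a b); case: has.
have sub : (#|U :\: [set b in U | hit a b]| = #|U| - #|[set b in U | hit a b]|)%N.
  rewrite cardsD; congr (_ - _)%N; apply: eq_card => b; rewrite !inE.
  by case: (b \in B0); case: has; case: (hit a b).
rewrite sub !expnS.
have step : (D * (#|U| - #|[set b in U | hit a b]|) <= D.-1 * #|U|)%N by nia.
rewrite [leqLHS]mulnAC mulnC; apply: leq_trans (leq_mul (leqnn _) step) _.
by rewrite mulnCA -mulnA leq_mul2l leX orbT.
Qed.

(** For [D > 1], with [x = D - 1], Bernoulli's inequality gives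
    [(1 + 1 / x) ^ D >= 1 + D / x >= 2]. *)
Lemma expn_self_double (D : nat) : (0 < D)%N -> (2 * D.-1 ^ D <= D ^ D)%N.
Proof.
case: D => [|[|D]] //=.
have H j : (D.+1 ^ j * (D.+1 + j) <= D.+2 ^ j * D.+1)%N.
  by elim: j => [|j IH]; rewrite ?expnS; nia.
have := H D.+2; nia.
Qed.

(** Bernoulli's inequality [(1 - l / s) ^ j >= 1 - j l / s] cleared of denominators; truncated
    subtraction covers the negative cases. *)
Lemma bernoulli_expn_sub (s l j : nat) : ((s - j * l) * s ^ j <= s * (s - l) ^ j)%N.
Proof.
elim: j => [|j IH]; first by rewrite !expn0 mul0n subn0.
rewrite !expnS mulSn.
have : ((s - (l + j * l)) * s <= (s - j * l) * (s - l))%N.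
  have [le|lt] := leqP (l + j * l) s; last by rewrite (eqP (ltnW lt)).
  nia.
move: IH; set x := (s - _)%N; set y := (s - (_ + _))%N; nia.
Qed.

Lemma ffact_leq_expn (n l : nat) : (n ^_ l <= n ^ l)%N.
Proof.
rewrite ffact_prod -[l in leqRHS]card_ord -prod_nat_const.
by apply: leq_prod => i _; apply: leq_subr.
Qed.

Lemma expn_leq_ffact (n l : nat) : ((n - l) ^ l <= n ^_ l)%N.
Proof.
rewrite ffact_prod -[l in leqLHS](card_ord l) -prod_nat_const.
by apply: leq_prod => i _; have := ltn_ord i; rewrite card_ord; lia.
Qed.

(** With [s = 2 l ^ 2] the ratio is at most [k ^ l / (1 - l / s) ^ l], and Bernoulli bounds the
    denominator below by [1 - l ^ 2 / s = 1 / 2]. *)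
Lemma binomial_ratio (k l : nat) : (0 < l)%N ->
  ('C(k * (2 * l ^ 2), l) <= 2 * k ^ l * 'C(2 * l ^ 2, l))%N.
Proof.
move=> l_gt0; set s := (2 * l ^ 2)%N.
rewrite -(leq_pmul2r (fact_gt0 l)) -mulnA !bin_ffact.
apply: leq_trans (ffact_leq_expn _ _) _.
apply: leq_trans (leq_mul (leqnn _) (expn_leq_ffact s l)).
have := bernoulli_expn_sub s l l.
have -> : (s - l * l = l ^ 2)%N by rewrite /s; nia.
have -> : (s * (s - l) ^ l = l ^ 2 * (2 * (s - l) ^ l))%N by rewrite {1}/s; nia.
rewrite leq_pmul2l ?expn_gt0 ?l_gt0 // => le.
by rewrite expnMn (mulnC 2) -mulnA leq_mul2l le orbT.
Qed.

(** A random [l]-set lies in a given [S] with probability at least [1 / D], where [D = 2 k ^ l].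
    Every [D] greedy choices halve the number of uncovered sets [S], so [D (n + 1)] choices leave
    fewer than one of the at most [2 ^ n]. *)
Lemma turan_family (k l : nat) (n := (k * (2 * l ^ 2))%N) :
  (0 < k)%N -> (0 < l)%N ->
  exists X : 'I_(2 * k ^ l * n.+1) -> {set 'I_n},
    (forall j, #|X j| = l) /\
    (forall S : {set 'I_n}, (2 * l ^ 2 <= #|S|)%N -> exists j, X j \subset S).
Proof.
move=> k_gt0 l_gt0; set M := (_ * _)%N.
pose D := (2 * k ^ l)%N.
pose A0 := [set A : {set 'I_n} | #|A| == l].
pose B0 := [set S : {set 'I_n} | 2 * l ^ 2 <= #|S|]%N.
have cardA0 : #|A0| = 'C(n, l) by rewrite card_draws card_ord.
have [||X [szX XA leX]] := @greedy_cover _ _ A0 (fun A S : {set 'I_n} => A \subset S) B0 D M.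
- by rewrite cardA0 bin_gt0 /n; nia.
- move=> S; rewrite inE cardA0 => leS.
  apply: leq_trans (binomial_ratio k l_gt0) _; rewrite leq_mul2l; apply/orP; right.
  have -> : [set a in A0 | a \subset S] = [set A : {set 'I_n} | A \subset S & #|A| == l].
    by apply/setP => A; rewrite !inE andbC.
  by rewrite cards_draws leq_bin2l.
have D_gt1 : (1 < D)%N by rewrite /D (leq_pmulr 2) // expn_gt0 k_gt0.
have U0 : [set S in B0 | ~~ has (fun A : {set 'I_n} => A \subset S) X] = finset.set0.
  apply/eqP; rewrite -cards_eq0 -leqn0 leqNgt; apply/negP => U_gt0.
  have leB : (#|B0| <= 2 ^ n)%N.
    rewrite -[n in leqRHS]card_ord -cardsT -card_powerset subset_leq_card //.
    by apply/fintype.subsetP => S _; rewrite powersetE finset.subsetT.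
  have le2 : (2 ^ n.+1 * D.-1 ^ M <= D ^ M)%N.
    have -> : M = (D * n.+1)%N by [].
    by rewrite !(expnM _ D) -expnMn leq_exp2r // expn_self_double // ltnW.
  have pred_gt0 : (0 < D.-1 ^ M)%N by rewrite expn_gt0; lia.
  have := leq_trans (leq_pmulr _ U_gt0) leX; rewrite leqNgt => /negP[].
  apply: leq_trans le2; rewrite mulnC ltn_pmul2r //.
  by apply: leq_ltn_trans leB _; rewrite ltn_exp2l.
have ltX (j : 'I_M) : (j < size X)%N by rewrite szX.
exists (fun j => nth finset.set0 X j); split=> [j|S leS].
  by have := XA _ (mem_nth finset.set0 (ltX j)); rewrite inE => /eqP.
have : S \notin [set S in B0 | ~~ has (fun A : {set 'I_n} => A \subset S) X].
  by rewrite U0 inE.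
rewrite !inE leS /= negbK => /(has_nthP finset.set0)[j]; rewrite szX => ltj sub.
by exists (Ordinal ltj).
Qed.

(** * Lower bound: lists on lines of a grid *)

(** The point at position [a] on the line through [p] in direction [i]. Any of the [n] points of a
    line can serve as [p], so sums over [p] count each line [n] times. *)
Definition line_point (k n : nat) (p : {ffun 'I_k -> 'I_n}) (i : 'I_k) (a : 'I_n) :
  {ffun 'I_k -> 'I_n} := [ffun i' => if i' == i then a else p i'].

Lemma line_point_inj (k n : nat) (p : {ffun 'I_k -> 'I_n}) (i : 'I_k) :
  injective (line_point p i).
Proof. by move=> a b /ffunP/(_ i); rewrite !ffunE eqxx. Qed.

Lemma sum_card_line_fiber (k n : nat) (i : 'I_k) (A : {set {ffun 'I_k -> 'I_n}}) :
  (\sum_p #|[set a | line_point p i a \in A]| = n * #|A|)%N.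
Proof.
(* [swap] exchanges [a] with the [i]-th coordinate of [p]. *)
pose swap (x : {ffun 'I_k -> 'I_n} * 'I_n) := (line_point x.1 i x.2, x.1 i).
have swapK : involutive swap.
  case=> p a; rewrite /swap /=; congr (_, _); last by rewrite ffunE eqxx.
  by apply/ffunP => i'; rewrite !ffunE; case: eqP => [->|].
under eq_bigr do rewrite -sum1dep_card.
rewrite pair_big_dep /= (reindex_inj (inv_inj swapK)) /=.
rewrite (eq_bigl (fun x => (x.1 \in A) && true)); last first.
  by move=> x; have := congr1 fst (swapK x); rewrite /= => ->; rewrite andbT.
rewrite -(pair_big (mem A) predT (fun _ _ => 1%N)) /=.
under eq_bigr do rewrite sum1_card card_ord.
by rewrite sum_nat_const mulnC.
Qed.

(** A point [c] is counted only on its line in direction [g c], once for each of the [n] base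
    points. The [k * n ^ k] pairs [(i, p)] thus have total count [n * n ^ k] and average [n / k]. *)
Lemma dense_line (k n : nat) (g : {ffun 'I_k -> 'I_n} -> 'I_k) :
  (0 < k)%N -> (0 < n)%N ->
  exists i p, (n <= k * #|[set a | g (line_point p i a) == i]|)%N.
Proof.
move=> k_gt0 n_gt0; apply: contrapT => none.
pose F (x : 'I_k * {ffun 'I_k -> 'I_n}) := #|[set a | g (line_point x.2 x.1 a) == x.1]|.
have ltF x : (k * F x < n)%N.
  by rewrite ltnNge; apply/negP => le; apply: none; exists x.1, x.2.
have sumF : (\sum_x F x = n * n ^ k)%N.
  rewrite -(pair_bigA _ (fun i p => F (i, p))) /=.
  under eq_bigr => i _.
    rewrite (eq_bigr (fun p => #|[set a | line_point p i a \in g @^-1: [set i]]|)).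
      rewrite sum_card_line_fiber; over.
    by move=> p _; apply: eq_card => a; rewrite !inE.
  rewrite -big_distrr /=; congr (_ * _)%N.
  under eq_bigr do rewrite -sum1dep_card.
  rewrite -[RHS](_ : #|{ffun 'I_k -> 'I_n}| = _); last by rewrite card_ffun !card_ord.
  rewrite -sum1_card [RHS](partition_big g predT) //=; apply: eq_bigr => i _.
  by apply: eq_bigl => c; rewrite !inE.
have : (\sum_x k * F x <= \sum_(x : 'I_k * {ffun 'I_k -> 'I_n}) n.-1)%N.
  by apply: leq_sum => x _; have := ltF x; lia.
rewrite -big_distrr /= sumF sum_nat_const card_prod card_ffun !card_ord.
have : (0 < k * n ^ k)%N by rewrite muln_gt0 k_gt0 expn_gt0 n_gt0.
rewrite mulnCA mulnC; nia.
Qed.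

Lemma not_sep_choosable (k m l : nat) (n := (k * (2 * l ^ 2))%N) :
  (0 < k)%N -> (0 < l)%N -> (n ^ k * (2 * k ^ l * n.+1) <= m)%N ->
  ~ sep_choosable (complete_partite k m) 1 l.
Proof.
move=> k_gt0 l_gt0 le_m colorable.
have n_gt0 : (0 < n)%N by rewrite /n; nia.
have [X [szX XP]] := turan_family k_gt0 l_gt0; rewrite -/n in X szX XP.
set M := (2 * k ^ l * n.+1)%N in X szX XP le_m.
have M_gt0 : (0 < M)%N by rewrite /M !muln_gt0 expn_gt0 k_gt0.
pose I := ({ffun 'I_k -> 'I_n} * 'I_M)%type.
have cardI : (#|{: I}| <= m)%N by rewrite card_prod card_ffun !card_ord.
(* Each part carries one list for every base point and every family member; [x0] labels the surplus
   vertices. *)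
pose x0 : I := ([ffun=> Ordinal n_gt0], Ordinal M_gt0).
pose idx (j : 'I_m) : I := nth x0 (enum {: I}) j.
have idx_onto x : exists j, idx j = x.
  have lt_m : (index x (enum {: I}) < m)%N.
    by apply: leq_trans cardI; rewrite cardE index_mem mem_enum.
  by exists (Ordinal lt_m); rewrite /idx nth_index // mem_enum.
pose L (v : 'I_k * 'I_m) := line_point (idx v.2).1 v.1 @: X (idx v.2).2.
have szL : @is_list_of_size (complete_partite k m) l _ L.
  by move=> v; rewrite card_imset ?szX //; apply: line_point_inj.
have sepL : @Defs.separated (complete_partite k m) 1 _ L.
  move=> u v neq_uv [e eE /andP[ue ve]].
  have neq_i : u.1 != v.1.
    apply: contra neq_uv => /eqP eq_i.
    move: eE; rewrite inE => /andP[_ /forallP/(_ u.1)/cards1P[w ew]].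
    have : u \in e :&: part m u.1 by rewrite !inE ue eqxx.
    have : v \in e :&: part m u.1 by rewrite !inE ve eq_i eqxx.
    by rewrite ew !inE => /eqP -> /eqP ->.
  apply/card_le1_eqP => c c'; rewrite !inE.
  move=> /andP[/imsetP[a _ ->] /imsetP[b _ eqb]] /andP[/imsetP[a' _ ->] /imsetP[b' _ eqb']].
  (* On the line of [v] the coordinate [u.1] is constant, which fixes the position of a common color
     on the line of [u]. *)
  have /ffunP/(_ u.1) := eqb; have /ffunP/(_ u.1) := eqb'.
  by rewrite !ffunE eqxx (negPf neq_i) => -> ->.
have [f [fL fP]] := colorable _ L szL sepL.
(* If every part used [c], choosing one vertex of color [c] in each part would give a monochromatic
   edge. *)
have missed c : exists i, forall j, f (i, j) <> c.
  apply: contrapT => none.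
  have hit i : exists j, f (i, j) = c.
    by apply: contrapT => noj; apply: none; exists i => j fj; apply: noj; exists j.
  have [h hP] := boolp.choice hit.
  apply: (fP _ (transversal_edge h)); exists c => v /imsetP[i _ ->]; exact: hP.
have [g gP] := boolp.choice missed.
have [i [p le_n]] := dense_line g k_gt0 n_gt0.
have [|r Xsub] := XP [set a | g (line_point p i a) == i].
  by rewrite -(leq_pmul2l k_gt0).
have [j idxj] := idx_onto (p, r).
have /imsetP[a] := fL (i, j); rewrite /= idxj /= => aX fij.
have := fintype.subsetP Xsub a aX; rewrite inE -fij => /eqP gf.
by apply: (gP (f (i, j)) j); rewrite gf.
Qed.

Lemma sqr_leq_exp2 (v : nat) : (v.+1 ^ 2 <= 4 * 2 ^ v)%N.
Proof. by case: v => // v; elim: v => // v; rewrite !(expnS 2); nia. Qed.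

(** With [b = (4 k l) ^ 2], the polynomial factors satisfy [n ^ k <= b ^ k] and
    [2 (n + 1) <= b ^ 2]. *)
Lemma not_sep_choosable_exp (k m l : nat) :
  (1 < k)%N -> (0 < l)%N -> (k ^ l * (4 * k * l) ^ (2 * k.+2) <= m)%N ->
  ~ sep_choosable (complete_partite k m) 1 l.
Proof.
move=> k_gt1 l_gt0 le_m; apply: not_sep_choosable => //; first exact: ltnW.
apply: leq_trans le_m; set n := (k * _)%N.
have le_n : (2 * n <= (4 * k * l) ^ 2)%N by rewrite /n; nia.
have n_gt0 : (0 < n)%N by rewrite /n; nia.
set b := ((4 * k * l) ^ 2)%N in le_n; rewrite expnM -/b !expnS.
have : (n ^ k <= b ^ k)%N by rewrite leq_exp2r; lia.
have : (2 * n.+1 <= b * b)%N by nia.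
move: (n ^ k)%N (b ^ k)%N (k ^ l)%N => x y z le1 le2.
have -> : (x * (2 * z * n.+1) = z * (2 * n.+1 * x))%N by lia.
by rewrite leq_mul2l mulnA leq_mul ?orbT.
Qed.

(** * Bounds on both chromatic numbers in terms of [trunc_log k m] *)

Lemma is_least_leastP (P : nat -> Prop) (n : nat) : P n -> is_least P (least P).
Proof.
move=> Pn; rewrite /least; apply: xgetPex.
have exP : exists n, `[< P n >] by exists n; apply/asboolP.
exists (ex_minn exP); case: ex_minnP => j /asboolP Pj minj.
by split=> // i Pi; apply: minj; apply/asboolP.
Qed.

(** Shrinking lists keeps them separated. Hence one size that fails bounds the least choosable size
    from below. *)
Lemma sep_choosable_mono (G : hypergraph) (s l l' : nat) :
  (l <= l')%N -> sep_choosable G s l -> sep_choosable G s l'.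
Proof.
move=> le_l choos C L szL sepL.
have sub v : exists A : {set C}, A \subset L v /\ #|A| = l.
  have : (0 < #|[set A : {set C} | A \subset L v & #|A| == l]|)%N.
    by rewrite cards_draws szL bin_gt0.
  by case/card_gt0P => A; rewrite inE => /andP[? /eqP]; exists A.
have [L' L'P] := boolp.choice sub.
have [|u v neq ed|f [fL fP]] := choos C L'.
- by move=> v; case: (L'P v).
- apply: leq_trans (sepL u v neq ed); apply: subset_leq_card.
  by apply: finset.setISS; [case: (L'P u)|case: (L'P v)].
exists f; split=> // v; case: (L'P v) => + _; move=> /fintype.subsetP; exact.
Qed.

Lemma choosable_trunc_log (k m : nat) : (1 < k)%N ->
  choosable (complete_partite k m) (trunc_log k m).+2.
Proof.
move=> k_gt1; apply: complete_partite_choosable; first exact: ltnW.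
by rewrite expnS ltn_pmul2l ?trunc_log_ltn // ltnW.
Qed.

Lemma list_chromatic_bounds (k m : nat) (G := complete_partite k m) :
  (1 < k)%N ->
  (sep_list_chromatic G 1 <= list_chromatic G <= (trunc_log k m).+2)%N.
Proof.
move=> k_gt1.
have choos := @choosable_trunc_log k m k_gt1.
have [chooschi min_chi] := is_least_leastP choos.
apply/andP; split; last exact: min_chi.
have schoos : sep_choosable G 1 (list_chromatic G) by move=> C L szL _; exact: chooschi.
by have [_] := is_least_leastP schoos; apply.
Qed.

Lemma leq_sep_list_chromatic (k m l : nat) :
  (1 < k)%N -> (k ^ l * (4 * k * l) ^ (2 * k.+2) <= m)%N ->
  (l <= sep_list_chromatic (complete_partite k m) 1)%N.
Proof.
move=> k_gt1 le_m; have [->//|l_gt0] := posnP l.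
rewrite leqNgt; apply/negP => lt.
apply: (not_sep_choosable_exp k_gt1 l_gt0 le_m).
apply: sep_choosable_mono (ltnW lt) _.
have schoos : sep_choosable (complete_partite k m) 1 (trunc_log k m).+2.
  by move=> C L szL _; exact: choosable_trunc_log.
by have [] := is_least_leastP schoos.
Qed.

(** With [T = trunc_log k m], the size [l = T - v d] gives up at most [T / N]. The freed factor
    [k ^ (v d)] absorbs [(4 k l) ^ d], since [4 k l <= A (v + 1) <= 2 ^ v]. *)
Lemma sep_list_chromatic_lower (k N : nat) : (1 < k)%N -> (0 < N)%N ->
  exists T0, forall m, (0 < m)%N -> (T0 <= trunc_log k m)%N ->
  (N.-1 * trunc_log k m <= N * sep_list_chromatic (complete_partite k m) 1)%N.
Proof.
move=> k_gt1 N_gt0; pose d := (2 * k.+2)%N; pose A := (4 * k * (N * d))%N.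
exists (N * d * (4 * A))%N => m m_gt0; set T := trunc_log k m => le_T.
have Nd_gt0 : (0 < N * d)%N by rewrite muln_gt0 N_gt0.
pose v := (T %/ (N * d))%N.
have le_v : (4 * A <= v)%N by rewrite /v leq_divRL // mulnC.
have lt_T : (T < N * d * v.+1)%N by rewrite mulnC -ltn_divLR.
have vT : (v * (N * d) <= T)%N by apply: leq_divM.
(* From [4 A <= v] follows [4 A (v + 1) <= (v + 1) ^ 2 <= 4 * 2 ^ v]. *)
have exp_v : (A * v.+1 <= 2 ^ v)%N by have := sqr_leq_exp2 v; nia.
have le_l : (T - v * d <= sep_list_chromatic (complete_partite k m) 1)%N.
  apply: leq_sep_list_chromatic => //.
  apply: leq_trans (trunc_logP k_gt1 m_gt0); rewrite -/T.
  have vd_T : (v * d <= T)%N by apply: leq_trans vT; rewrite mulnCA leq_pmull.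
  rewrite -[X in (_ <= k ^ X)%N](subnK vd_T) expnD leq_mul2l; apply/orP; right.
  rewrite (expnM k) -/d leq_exp2r //.
  apply: leq_trans (_ : 2 ^ v <= _)%N; last by rewrite leq_exp2r //; lia.
  apply: leq_trans exp_v; rewrite /A -[leqRHS]mulnA leq_mul2l; apply/orP; right.
  by apply: leq_trans (ltnW lt_T); apply: leq_subr.
apply: leq_trans (_ : N * (T - v * d) <= _)%N; last by rewrite leq_mul2l le_l orbT.
rewrite mulnBr -subn1 mulnBl mul1n leq_sub2l //.
by rewrite mulnCA.
Qed.

(** * Passage to the limit *)

Import numFieldNormedType.Exports.
Import Order.TTheory GRing.Theory Num.Theory.
Local Open Scope classical_set_scope.
Local Open Scope ring_scope.

Lemma logb_bounds (R : realType) (k m : nat) : (1 < k)%N -> (0 < m)%N ->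
  (trunc_log k m)%:R <= logb R k m <= (trunc_log k m).+1%:R.
Proof.
move=> k_gt1 m_gt0; rewrite /logb.
have k_gt0 : 0 < k%:R :> R by rewrite ltr0n ltnW.
have lnk_gt0 : 0 < ln k%:R :> R by rewrite ln_gt0 // ltr1n.
have le1 := trunc_logP k_gt1 m_gt0; have lt2 := trunc_log_ltn m k_gt1.
rewrite ler_pdivlMr // ler_pdivrMr // !mulr_natl -!lnXn //.
rewrite !ler_ln ?posrE ?ltr0n ?exprn_gt0 // -!natrX !ler_nat.
by rewrite le1 ltnW.
Qed.

Lemma near_trunc_log_ge (k K : nat) : (1 < k)%N ->
  \forall m \near \oo, (0 < m)%N /\ (K <= trunc_log k m)%N.
Proof.
move=> k_gt1; exists (k ^ K)%N => // m /= le_m; split.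
  by apply: leq_trans le_m; rewrite expn_gt0 ltnW.
exact: trunc_log_max.
Qed.

Lemma cvg_div_logb (R : realType) (k : nat) (u : nat -> nat) : (1 < k)%N ->
  (forall m, (0 < m)%N -> (u m <= (trunc_log k m).+2)%N) ->
  (forall N, (0 < N)%N -> exists T0, forall m, (0 < m)%N ->
     (T0 <= trunc_log k m)%N -> (N.-1 * trunc_log k m <= N * u m)%N) ->
  (fun m => (u m)%:R / logb R k m : R) @ \oo --> (1 : R).
Proof.
move=> k_gt1 upper lower; apply/cvgrPdist_le => e e_gt0.
(* The errors are a bounded term and a term [x / N], with [x] the logarithm. As [N > 3 / e], and
   [x >= N] once [trunc_log k m >= N], both [3] and [3 x / N] are at most [e x]. *)
pose N := (Num.bound (3 / e)).+1.
have lt_N : 3 / e < N%:R.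
  apply: lt_le_trans (archi_boundP _) _; first by rewrite divr_ge0 // ltW.
  by rewrite ler_nat.
have [T0 lowerN] := lower N isT.
near=> m.
have [m_gt0 le_T] : (0 < m)%N /\ (maxn T0 N <= trunc_log k m)%N.
  by near: m; apply: near_trunc_log_ge.
move: le_T; rewrite geq_max => /andP[le_T0 le_N].
have /andP[] := logb_bounds R k_gt1 m_gt0.
move: (logb R k m) (upper m m_gt0) (lowerN m m_gt0 le_T0) => x.
move: (trunc_log k m) le_N => T le_N.
rewrite -!(ler_nat R) !natrM => le_up le_lo le_Tx le_xT.
have N1 : N.-1%:R = N%:R - 1 :> R by rewrite [N%:R]mulrS addrC addrK.
rewrite N1 in le_lo; move: le_up le_xT; rewrite -!natr1 => le_up le_xT.
have {}le_N : N%:R <= T%:R :> R by rewrite ler_nat.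
have N_gt0 : 0 < N%:R :> R by rewrite ltr0n.
have eN : 3 <= e * N%:R by rewrite mulrC -ler_pdivrMr // ltW.
have x_gt0 : 0 < x by lra.
have ex : 3 <= e * x by apply: le_trans eN _; rewrite ler_pM2l //; lra.
have -> : 1 - (u m)%:R / x = (x - (u m)%:R) / x by field; rewrite gt_eqF.
rewrite normrM normfV (gtr0_norm x_gt0) ler_pdivrMr // ler_norml.
apply/andP; split; first by lra.
rewrite -(ler_pM2l N_gt0).
have : 3 * x <= e * N%:R * x by rewrite ler_pM2r.
have : N%:R * 3 <= N%:R * (e * x) by rewrite ler_pM2l.
have : N%:R * x <= N%:R * (T%:R + 1) by rewrite ler_pM2l.
nra.
Unshelve. all: by end_near.
Qed.

Theorem theorem4 (R : realType) (k : nat) (hk : (2 <= k)%N) :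
  [/\ (fun m : nat => (sep_list_chromatic (complete_partite k m) 1)%:R
                      / (list_chromatic (complete_partite k m))%:R : R)
        @ \oo --> (1 : R),
      (fun m : nat => (sep_list_chromatic (complete_partite k m) 1)%:R
                      / logb R k m : R)
        @ \oo --> (1 : R)
    & (fun m : nat => (list_chromatic (complete_partite k m))%:R
                      / logb R k m : R)
        @ \oo --> (1 : R)].
Proof.
have sep_cvg : (fun m : nat => (sep_list_chromatic (complete_partite k m) 1)%:R
                      / logb R k m : R) @ \oo --> (1 : R).
  apply: cvg_div_logb => // [m _|N]; last exact: sep_list_chromatic_lower.
  by have /andP[/leq_trans + ?] := list_chromatic_bounds m hk; apply.
have cvg : (fun m : nat => (list_chromatic (complete_partite k m))%:R
                      / logb R k m : R) @ \oo --> (1 : R).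
  apply: cvg_div_logb => // [m _|N N_gt0].
    by have /andP[] := list_chromatic_bounds m hk.
  have [T0 T0P] := sep_list_chromatic_lower hk N_gt0.
  exists T0 => m m_gt0 le_T; apply: leq_trans (T0P m m_gt0 le_T) _.
  by have /andP[le_sep _] := list_chromatic_bounds m hk; rewrite leq_mul2l le_sep orbT.
split=> //.
rewrite -[X in _ --> X]divr1.
(* The quotient of the two ratios equals the desired one once [logb R k m] is nonzero, which
   [trunc_log k m >= 1] ensures. *)
apply: cvg_trans (cvgM sep_cvg (cvgV (oner_neq0 R) cvg)); apply: near_eq_cvg; near=> m.
have [m_gt0 T_gt0] : (0 < m)%N /\ (1 <= trunc_log k m)%N.
  by near: m; apply: near_trunc_log_ge.
have /andP[le_Tx _] := logb_bounds R hk m_gt0.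
have x_neq0 : logb R k m != 0.
  by rewrite gt_eqF // (lt_le_trans _ le_Tx) // ltr0n.
by rewrite /=; move: (logb R k m) x_neq0 => x x0; rewrite invf_div mulrA divfK.
Unshelve. all: by end_near.
Qed.
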